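(* $\mathfrak{L}(SL(2,\mathbb{Z})) \subsetneq \mathfrak{L}(SL(2,\mathbb{Q}))$.
   Context: For a group $G$ with identity $e$, a $G$-automaton is a tuple $(Q,\Sigma,G,\delta,q_0,Q_a)$ where $Q$ is a finite set of states, $\Sigma$ a finite input alphabet, $q_0\in Q$ the initial state, $Q_a\subseteq Q$ the accepting states, and $\delta$ assigns to each $(q,\sigma)\in Q\times(\Sigma\cup\{\varepsilon\})$ a finite set of pairs $(q',m)\in Q\times G$. The register holds an element of $G$, initially $e$; using a transition $(q',m)\in\delta(q,\sigma)$ the automaton reads $\sigma$ (or nothing), moves to $q'$ and replaces the register content $x$ by $xm$. A word is accepted if some computation reads it entirely and ends in an accepting state with register equal to $e$. $\mathfrak{L}(G)$ is the class of languages recognized by $G$-automata. $SL(2,\mathbb{Z})$ (resp. $SL(2,\mathbb{Q})$) is the group of $2\times2$ matrices with integer (resp. rational) entries and determinant $1$. *)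

(* Defs.v *)
From Stdlib Require Import List.
From HB Require Import structures.
From mathcomp Require Import all_boot all_order all_algebra.
Set Implicit Arguments. Unset Strict Implicit. Unset Printing Implicit Defensive.
Import GRing.Theory.
Local Open Scope ring_scope.

(* G-automaton: finite state set, finite alphabet, finite transition relation
   given as a list of (q, sigma or epsilon (None), q', m). *)
Record GAut (G : Type) (Sigma : finType) := {
  gstate : finType;
  ginit : gstate;
  gacc : {set gstate};
  gtrans : seq (gstate * option Sigma * gstate * G)
}.

Inductive run (G : Type) (mul : G -> G -> G) (e : G) (Sigma : finType)
    (A : GAut G Sigma) : gstate A -> G -> seq Sigma -> Prop :=
| run_end q x : q \in gacc A -> x = e -> @run G mul e Sigma A q x [::]
| run_read q x a w q' m :
    List.In (q, Some a, q', m) (gtrans A) ->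
    @run G mul e Sigma A q' (mul x m) w -> @run G mul e Sigma A q x (a :: w)
| run_eps q x w q' m :
    List.In (q, None, q', m) (gtrans A) ->
    @run G mul e Sigma A q' (mul x m) w -> @run G mul e Sigma A q x w.

Definition accepts G (mul : G -> G -> G) (e : G) Sigma (A : GAut G Sigma)
  (w : seq Sigma) : Prop := @run G mul e Sigma A (ginit A) e w.

Definition LG G (mul : G -> G -> G) (e : G) (Sigma : finType)
  (L : seq Sigma -> Prop) : Prop :=
  exists A : GAut G Sigma, forall w, L w <-> accepts mul e A w.

Definition SL2 (R : comRingType) := {M : 'M[R]_2 | \det M == 1}.

Lemma SL2_mul_det (R : comRingType) (A B : SL2 R) :
  \det (proj1_sig A *m proj1_sig B) == 1.
Proof. by rewrite det_mulmx (eqP (proj2_sig A)) (eqP (proj2_sig B)) mulr1. Qed.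

Lemma SL2_one_det (R : comRingType) : \det (1%:M : 'M[R]_2) == 1.
Proof. by rewrite det1. Qed.

Definition SL2_mul (R : comRingType) (A B : SL2 R) : SL2 R :=
  exist _ (proj1_sig A *m proj1_sig B) (SL2_mul_det A B).
Definition SL2_one (R : comRingType) : SL2 R := exist _ 1%:M (SL2_one_det R).

Definition L_SL2 (R : comRingType) (Sigma : finType) (L : seq Sigma -> Prop) :=
  LG (@SL2_mul R) (SL2_one R) L.

(* Main.v *)
From Stdlib Require Import List.
Require Import Defs.
From mathcomp Require Import all_boot all_order all_algebra.
From mathcomp Require Import zify ring.
Set Implicit Arguments. Unset Strict Implicit. Unset Printing Implicit Defensive.
Import Order.TTheory GRing.Theory Num.Theory.

(** The witness is the unary language of the words a^(4^n).  In SL(2,Q), put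
    D = diag(2, 1/2) and E = [[1,1],[0,1]]; as D^n E D^-n = E^(4^n), an automaton
    that multiplies by D^n E D^-m without reading and then by E^-1 for each letter
    ends at the identity on a^k exactly when m = n and k = 4^n.

    For SL(2,Z), let B be the union of the subgroups generated by an element S of
    order 4 and an element U of order 6.  SL(2,Z) is their amalgam over {1,-1}, so
    by ping-pong every product of at least two elements of B that equals 1 has two
    adjacent factors whose product lies in B.  Splitting the register updates
    into factors from B, an accepting computation can be contracted by merging
    adjacent steps; this is a binary parse tree whose labels (source, element of B,
    target) range over a finite set.  The pumping argument for context-free grammars
    then yields arithmetic progressions of accepted lengths, whereas the powers of 4
    contain none. *)

(** * Pumping for weighted parse trees *)

Section Pumping.
Variables (X : eqType) (leaf : X -> nat -> Prop) (node : X -> X -> X -> Prop).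

(** Derivation trees of a grammar with binary rules over a one-letter alphabet; the derived word is
    recorded by its length alone. *)
Inductive tree : X -> nat -> Prop :=
| tree_leaf x n : leaf x n -> tree x n
| tree_node x y z n m : node x y z -> tree y n -> tree z m -> tree x (n + m).

(* From x, a tree with a hole labelled y and weight k outside the hole. *)
Definition ctx x y k := forall m, tree y m -> tree x (m + k).

Lemma ctx_trans x y z k l : ctx x y k -> ctx y z l -> ctx x z (k + l).
Proof. by move=> xy yz m /yz /xy; rewrite -addnA (addnC l). Qed.

Lemma ctx_iter y k i : ctx y y k -> ctx y y (i * k).
Proof.
move=> yy; elim: i => [|i IH]; first by move=> m; rewrite mul0n addn0.
by rewrite mulSn; apply: ctx_trans yy IH.
Qed.

Hypothesis leaf_le1 : forall x n, leaf x n -> n <= 1.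

(** If both children have positive weight, take the heavier one; its sibling supplies the positive
    [k]. A sibling of weight 0 is absorbed into the context given by the induction hypothesis. *)
Lemma tree_descend x n : tree x n -> 1 < n ->
  exists y m k, [/\ 0 < k, ctx x y k, tree y m, n = m + k & n <= m.*2].
Proof.
elim=> {x n} [x n /leaf_le1|x y z n m xyz yn IHy zm IHz]; first by lia.
have xy : ctx x y m by move=> i yi; apply: tree_node xyz yi zm.
have xz : ctx x z n by move=> i zi; rewrite addnC; apply: tree_node xyz yn zi.
case: n m => [|n] [|m] // in yn IHy zm IHz xy xz *.
- case/IHz=> u [i [k [k0 zu ui -> le]]]; exists u, i, k; split=> //.
  by have := ctx_trans xz zu.
- rewrite addn0; case/IHy=> u [i [k [k0 yu ui -> le]]]; exists u, i, k; split=> //.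
  by have := ctx_trans xy yu.
- move=> _; case: (leqP n m) => nm.
    by exists z, m.+1, n.+1; split=> //; lia.
  by exists y, n.+1, m.+1; split=> //; lia.
Qed.

Variable labels : seq X.
Hypothesis tree_labels : forall x n, tree x n -> x \in labels.

(** By pigeonhole some label repeats along a branch with positive weight in between, and the context
    from that label to itself can be iterated. *)
Lemma tree_pump x n : tree x n -> 2 ^ size labels <= n ->
  exists2 k, 0 < k & forall i, tree x (n + i * k).
Proof.
move=> xn len.
suff: exists y m j k, [/\ 0 < k, ctx x y j, ctx y y k, tree y m & n = m + k + j].
  case=> y [m [j [k [k0 xy yy ym ->]]]]; exists k => // i.
  have := xy _ (ctx_iter i.+1 yy ym); congr tree; lia.
(* Always descend to the heavier child: the weight is at most halved at each proper
   step, so at least [size labels] proper steps are possible; [seen] collects the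
   labels at which they were made. *)
suff aux d : forall y m (seen : seq X),
    uniq seen -> {subset seen <= labels} -> size labels <= size seen + d ->
    2 ^ d <= m -> tree y m ->
    (exists2 j, ctx x y j & n = m + j) ->
    (forall z, z \in seen ->
       exists j k, [/\ 0 < k, ctx x z j, ctx z y k & n = m + k + j]) ->
    exists y m j k, [/\ 0 < k, ctx x y j, ctx y y k, tree y m & n = m + k + j].
  apply: (aux (size labels) x n [::]) => //; exists 0; last by rewrite addn0.
  by move=> m; rewrite addn0.
elim: d => [|d IH] y m seen useen sub le_sz le_m ym [j0 xy nE] seenP.
all: have [/seenP[j [k [k0 xy' yy E]]]|yNseen] := boolP (y \in seen);
  first by exists y, m, j, k.
all: have useen' : uniq (y :: seen) by rewrite /= yNseen.
all: have sub' : {subset y :: seen <= labels}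
  by move=> z; rewrite inE => /orP[/eqP->|/sub//]; apply: tree_labels ym.
  (* With [d = 0], [y :: seen] would be a duplicate-free list of more labels than exist. *)
  by have := uniq_leq_size useen' sub'; rewrite /=; lia.
have m_gt1 : 1 < m by apply: leq_trans le_m; rewrite expnS; have := expn_gt0 2 d; lia.
have [z [i [k [k0 yz zi mE le2]]]] := tree_descend ym m_gt1.
apply: (IH z i (y :: seen)) => //=.
- by rewrite addSnnS.
- by move: le_m; rewrite expnS; lia.
- by exists (j0 + k); [apply: ctx_trans xy yz | lia].
move=> u; rewrite inE => /orP[/eqP->|/seenP[j [l [l0 xu uy E]]]].
  by exists j0, k; split=> //; lia.
by exists j, (l + k); split; [lia | | apply: ctx_trans uy yz | lia].
Qed.

End Pumping.

Lemma pow4_pump k : 0 < k -> forall n, ~ forall i, exists m, 4 ^ n + i * k = 4 ^ m.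
Proof.
(* This index turns the term into [4 ^ n * (1 + 2 * k)], whose odd factor exceeds 1. *)
move=> k0 n /(_ (2 * 4 ^ n)) [m E].
have {}E : 4 ^ n * (1 + 2 * k) = 4 ^ m by rewrite -E; lia.
have : (1 + 2 * k) %| 4 ^ m by rewrite -E dvdn_mull.
have cop : coprime (1 + 2 * k) (4 ^ m).
  by rewrite coprimeXr // (coprimeXr 2 (_ : coprime _ 2)) // coprimen2 oddD oddM.
by move=> /coprime_dvdr/(_ cop); rewrite /coprime gcdnn; lia.
Qed.

Local Open Scope ring_scope.

(** * Two-by-two matrices as quadruples *)

Section Quad.
Variable R : comNzRingType.

Local Notation quad := (R * R * R * R)%type.

Definition qmul (x y : quad) : quad :=
  let: (a, b, c, d) := x in let: (a', b', c', d') := y in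
  (a * a' + b * c', a * b' + b * d', c * a' + d * c', c * b' + d * d').

Definition qone : quad := (1, 0, 0, 1).

Definition qprod (l : seq quad) : quad := foldr qmul qone l.

Lemma qmulA : associative qmul.
Proof.
by case=> [[[a b] c] d] [[[a1 b1] c1] d1] [[[a2 b2] c2] d2];
  rewrite /qmul; congr (_, _, _, _); ring.
Qed.

Lemma qmul1 : right_id qone qmul.
Proof. by case=> [[[a b] c] d]; rewrite /qmul /=; congr (_, _, _, _); ring. Qed.

Lemma q1mul : left_id qone qmul.
Proof. by case=> [[[a b] c] d]; rewrite /qmul /=; congr (_, _, _, _); ring. Qed.

Global Arguments qmul : simpl never.

Lemma qprod_cat l1 l2 : qprod (l1 ++ l2) = qmul (qprod l1) (qprod l2).
Proof. by elim: l1 => [|x l1 /= ->]; rewrite ?q1mul // qmulA. Qed.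

Definition quad_of (M : SL2 R) : quad :=
  let A := proj1_sig M in (A 0 0, A 0 1, A 1 0, A 1 1).

Lemma quad_of_inj : injective quad_of.
Proof.
case=> [A detA] [B detB] [] /= e00 e01 e10 e11; apply: val_inj => /=.
have ord2 (i : 'I_2) : i = 0 \/ i = 1.
  by case: i => -[|[|//]] lti; [left | right]; apply/val_inj.
by apply/matrixP => i j; case: (ord2 i) => ->; case: (ord2 j) => ->.
Qed.

Lemma quad_of_mul M N : quad_of (SL2_mul M N) = qmul (quad_of M) (quad_of N).
Proof.
rewrite /quad_of /= !mxE !big_ord_recl !big_ord0 !addr0.
by rewrite (_ : lift ord0 ord0 = 1 :> 'I_2) //; apply/val_inj.
Qed.

Lemma quad_of_one : quad_of (SL2_one R) = qone.
Proof. by rewrite /quad_of /= !mxE. Qed.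

Definition mx_of_quad (x : quad) : 'M[R]_2 :=
  let: (a, b, c, d) := x in
  \matrix_(i, j) (if i == 0 then if j == 0 then a else b
                  else if j == 0 then c else d).

Definition qdet (x : quad) : R := let: (a, b, c, d) := x in a * d - b * c.

Lemma det_quad (A : 'M[R]_2) : \det A = A 0 0 * A 1 1 - A 0 1 * A 1 0.
Proof.
rewrite (expand_det_row _ 0) !big_ord_recl big_ord0 addr0 /cofactor !det_mx11 !mxE /=.
rewrite expr0 expr1 mul1r mulN1r mulrN.
by congr (_ * A _ _ - A _ _ * A _ _); apply/val_inj.
Qed.

Lemma det_mx_of_quad x : \det (mx_of_quad x) = qdet x.
Proof. by case: x => [[[a b] c] d]; rewrite det_quad !mxE. Qed.

Lemma qdet_quad_of M : qdet (quad_of M) = 1.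
Proof. by rewrite /= -det_quad; apply/eqP; case: M. Qed.

Lemma mx_of_quad_det x : qdet x = 1 -> \det (mx_of_quad x) == 1.
Proof. by rewrite det_mx_of_quad => ->. Qed.

Definition SL2_of_quad x (dx : qdet x = 1) : SL2 R :=
  exist _ (mx_of_quad x) (mx_of_quad_det dx).

Lemma SL2_of_quadK x (dx : qdet x = 1) : quad_of (SL2_of_quad dx) = x.
Proof. by case: x dx => [[[a b] c] d] dx; rewrite /quad_of /= !mxE. Qed.

End Quad.

(** * Inclusion of language classes along group embeddings *)

Lemma LG_inj_morph (G H : Type) (mulG : G -> G -> G) (eG : G)
    (mulH : H -> H -> H) (eH : H) (f : G -> H) :
    injective f -> (forall x y, f (mulG x y) = mulH (f x) (f y)) -> f eG = eH ->
  forall (Sigma : finType) (L : seq Sigma -> Prop),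
    LG mulG eG L -> LG mulH eH L.
Proof.
move=> f_inj fM f1 Sigma L [A LA].
pose A' : GAut H Sigma := {| gstate := gstate A; ginit := ginit A; gacc := gacc A;
  gtrans := [seq (t.1, f t.2) | t <- gtrans A] |}.
exists A' => w; rewrite LA /accepts.
have inA' q o q' m : List.In (q, o, q', m) (gtrans A') ->
    exists2 n, m = f n & List.In (q, o, q', n) (gtrans A).
  rewrite /=; elim: (gtrans A) => //= -[[[q1 o1] q2] n] s IH.
  case=> [[<- <- <- <-]|/IH[n' -> n'in]]; first by exists n; [|left].
  by exists n'; [|right].
have inA q o q' n : List.In (q, o, q', n) (gtrans A) ->
    List.In (q, o, q', f n) (gtrans A').
  exact: (in_map (fun t : _ * G => (t.1, f t.2))).
have fwd q x v : @run G mulG eG Sigma A q x v -> @run H mulH eH Sigma A' q (f x) v.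
  elim=> {q x v} [q x qacc ->|q x a v q' m /inA tr _ IH|q x v q' m /inA tr _ IH].
  - exact: run_end.
  - by apply: run_read tr _; rewrite -fM.
  - by apply: run_eps tr _; rewrite -fM.
(* Injectivity of [f] turns a final register [eH] back into [eG]. *)
have bwd q y v : @run H mulH eH Sigma A' q y v ->
    forall x, f x = y -> @run G mulG eG Sigma A q x v.
  elim=> {q y v} [q y qacc ->|q y a v q' m tr _ IH|q y v q' m tr _ IH] x xE.
  - by apply: run_end => //; apply: f_inj; rewrite f1.
  - have [n mE tr'] := inA' _ _ _ _ tr.
    by apply: run_read tr' _; apply: IH; rewrite fM xE mE.
  - have [n mE tr'] := inA' _ _ _ _ tr.
    by apply: run_eps tr' _; apply: IH; rewrite fM xE mE.
by split=> [/fwd|r]; [rewrite f1 | exact: bwd _ _ _ r _ f1].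
Qed.

Lemma L_SL2_int_rat (Sigma : finType) (L : seq Sigma -> Prop) :
  L_SL2 int L -> L_SL2 rat L.
Proof.
have det_intr (M : SL2 int) : \det (map_mx (intr : int -> rat) (proj1_sig M)) == 1.
  by rewrite det_map_mx (eqP (proj2_sig M)).
pose f (M : SL2 int) : SL2 rat :=
  exist (fun N : 'M[rat]_2 => is_true (\det N == 1)) _ (det_intr M).
apply: (@LG_inj_morph _ _ _ _ _ _ f) => [M N [] MN | M N |].
- apply: val_inj; move/matrixP: MN => MN; apply/matrixP=> i j.
  by apply: (@intr_inj rat); have := MN i j; rewrite !mxE.
- by apply: val_inj; rewrite /= map_mxM.
- by apply: val_inj; rewrite /= map_mx1.
Qed.

(** * Ping-pong and generation in SL(2,Z) *)

Local Notation zquad := (int * int * int * int)%type.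

Definition central : seq zquad := [:: (1, 0, 0, 1); (-1, 0, 0, -1)].
(* The elements of <S> and of <U> outside {1,-1}, for S = [[0,-1],[1,0]] and
   U = [[0,1],[-1,1]]. *)
Definition quarter_turns : seq zquad := [:: (0, -1, 1, 0); (0, 1, -1, 0)].
Definition sixth_turns : seq zquad :=
  [:: (0, -1, 1, -1); (0, 1, -1, 1); (-1, 1, -1, 0); (1, -1, 1, 0)].
Definition factors : seq zquad := central ++ quarter_turns ++ sixth_turns.

Lemma forall_in_seq (T : eqType) (P : T -> Prop) (s : seq T) :
  foldr (fun x Q => P x /\ Q) True s -> forall x, x \in s -> P x.
Proof.
elim: s => //= y s IH [Py Ps] x; rewrite inE => /orP[/eqP-> //|]; exact: IH.
Qed.

Lemma central_factors x y : x \in central -> y \in factors ->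
  qmul x y \in factors /\ qmul y x \in factors.
Proof.
move=> xc; move: y; apply: forall_in_seq; move: x xc; apply: forall_in_seq.
by vm_compute; do !split.
Qed.

Lemma quarter_factors x y : x \in quarter_turns -> y \in quarter_turns ->
  qmul x y \in factors.
Proof.
move=> xc; move: y; apply: forall_in_seq; move: x xc; apply: forall_in_seq.
by vm_compute; do !split.
Qed.

Lemma sixth_factors x y : x \in sixth_turns -> y \in sixth_turns ->
  qmul x y \in factors.
Proof.
move=> xc; move: y; apply: forall_in_seq; move: x xc; apply: forall_in_seq.
by vm_compute; do !split.
Qed.

Definition qact (x : zquad) (v : int * int) : int * int :=
  let: (a, b, c, d) := x in (a * v.1 + b * v.2, c * v.1 + d * v.2).

Lemma qact_mul x y v : qact (qmul x y) v = qact x (qact y v).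
Proof.
case: x y v => [[[a b] c] d] [[[a1 b1] c1] d1] [s t].
by rewrite /qmul /=; congr pair; ring.
Qed.

Lemma qact_one v : qact (qone _) v = v.
Proof. by case: v => s t; congr pair; rewrite /=; ring. Qed.

(** [same_sign] and [opp_sign] are the two ping-pong sets, unions of opposite open quadrants; [m]
    bounds the l1-norm from below to record its growth. *)
Definition same_sign (m : int) (v : int * int) :=
  (0 < v.1 /\ 0 < v.2 /\ m <= v.1 + v.2) \/ (v.1 < 0 /\ v.2 < 0 /\ m <= - v.1 - v.2).
Definition opp_sign (m : int) (v : int * int) :=
  (0 < v.1 /\ v.2 < 0 /\ m <= v.1 - v.2) \/ (v.1 < 0 /\ 0 < v.2 /\ m <= v.2 - v.1).

Lemma quarter_act m v x : x \in quarter_turns -> same_sign m v -> opp_sign m (qact x v).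
Proof.
move=> + sv; move: x; apply: forall_in_seq; case: v sv => s t.
by rewrite /same_sign /opp_sign /=; lia.
Qed.

(** The norm of the image counts one coordinate of [v] twice, and that coordinate has absolute value
    at least 1. *)
Lemma sixth_act m v x : x \in sixth_turns -> opp_sign m v -> same_sign (m + 1) (qact x v).
Proof.
move=> + sv; move: x; apply: forall_in_seq; case: v sv => s t.
by rewrite /same_sign /opp_sign /=; lia.
Qed.

Definition mergeable (x y : zquad) := qmul x y \in factors.

(* Ping-pong: the start vector is chosen according to the last letter; sixth
   turns strictly increase the sum of the absolute values of the coordinates, which
   is 2 at the start, so that v is not fixed. *)
Lemma reduced_act x s : all (mem factors) (x :: s) ->
  sorted (fun x y => ~~ mergeable x y) (x :: s) -> s != [::] ->
  exists2 v, v = (1, 1) \/ v = (1, -1) &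
  (x \in quarter_turns /\ opp_sign 3 (qact (qprod (x :: s)) v) \/
   x \in sixth_turns /\ same_sign 3 (qact (qprod (x :: s)) v)).
Proof.
have cases y : y \in factors -> y \in central \/ y \in quarter_turns \/ y \in sixth_turns.
  by rewrite !mem_cat => /or3P[]; tauto.
elim: s x => // y s IH x /= /andP[xf /andP[yf sf]] /andP[xy ys] _.
have xNc : x \notin central by apply: contra xy => xc; case: (central_factors xc yf).
have yNc : y \notin central by apply: contra xy => yc; case: (central_factors yc xf).
have ysf : all (mem factors) (y :: s) by rewrite /= yf.
(* Adjacent letters alternate in kind, as two turns of the same kind merge. For a quarter turn [y]
   the bound 2 is enough: [x] is then a sixth turn and raises it to 3. *)
have key v m : v = (1, 1) \/ v = (1, -1) -> 2 <= m ->
  (y \in quarter_turns /\ opp_sign m (qact (qprod (y :: s)) v) \/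
   y \in sixth_turns /\ same_sign 3 (qact (qprod (y :: s)) v)) ->
   (x \in quarter_turns /\ opp_sign 3 (qact (qprod (x :: y :: s)) v) \/
    x \in sixth_turns /\ same_sign 3 (qact (qprod (x :: y :: s)) v)).
  move=> vE m2; rewrite [qprod (x :: _)]/= qact_mul.
  case: (cases _ xf) => [xc|[xq|xs]]; first by rewrite xc in xNc.
    case=> [[yq _]|[ys' ss]]; first by rewrite /mergeable quarter_factors in xy.
    by left; split=> //; apply: quarter_act ss.
  case=> [[yq ss]|[ys' _]]; last by rewrite /mergeable sixth_factors in xy.
  right; split=> //; have := sixth_act xs ss.
  by rewrite /same_sign; case: (qact _ _) => a b /=; lia.
case: s => [|z s] in sf ys IH ysf key *.
  case: (cases _ yf) => [yc|[yq|ys']]; first by rewrite yc in yNc.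
    exists (1, 1); first by left.
    apply: (key _ 2) => //; [by left | left; split=> //].
    by rewrite /= qact_mul qact_one; apply: quarter_act => //; left.
  exists (1, -1); first by right.
  apply: (key _ 2) => //; [by right | right; split=> //].
  by rewrite /= qact_mul qact_one; apply: (@sixth_act 2) => //; left.
have [v vE H] := IH y ysf ys isT.
by exists v => //; apply: (key _ 3).
Qed.

(** Without a mergeable pair, [reduced_act] would send a vector of norm 2 to one of norm at least
    3. *)
Lemma qprod1_mergeable s : all (mem factors) s -> (1 < size s)%N -> qprod s = qone _ ->
  exists s1 x y s2, s = s1 ++ x :: y :: s2 /\ mergeable x y.
Proof.
move=> sf s2 s1.
have [red|] := boolP (sorted (fun x y => ~~ mergeable x y) s).
  case: s => [|x [|y s]] // in s2 sf s1 red *.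
  have [] := reduced_act sf red isT.
  rewrite s1 => v; rewrite qact_one /same_sign /opp_sign => -[] -> [[_]|[_]] /=; lia.
case: s {sf s2 s1} => // x s /=; elim: s x => //= y s IH x.
rewrite negb_and negbK => /orP[xy|/IH[s1 [a [b [s2 [-> ab]]]]]].
  by exists [::], x, y, s.
by exists (x :: s1), a, b, s2.
Qed.

Definition generated (x : zquad) := exists2 l, all (mem factors) l & qprod l = x.

Lemma generated_factor x : x \in factors -> generated x.
Proof. by exists [:: x]; rewrite /= ?qmul1 ?andbT. Qed.

Lemma generated_mul x y : generated x -> generated y -> generated (qmul x y).
Proof. by move=> [l lf <-] [m mf <-]; exists (l ++ m); rewrite ?all_cat ?lf ?qprod_cat. Qed.

(** The shears with [k = 1] and [k = -1] are each a product of a quarter turn and a sixth turn in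
    some order; the others are their powers. *)
Lemma generated_shear (k : int) : generated (1, k, 0, 1).
Proof.
have nat_case (e : int) (n : nat) : generated (1, e, 0, 1) -> generated (1, e * n%:Z, 0, 1).
  move=> ge; elim: n => [|n IH]; first by rewrite mulr0; apply: generated_factor.
  rewrite (_ : (1, _, 0, 1) = qmul (1, e, 0, 1) (1, e * n%:Z, 0, 1)).
    exact: generated_mul.
  rewrite intS; move: n%:Z {IH} => m; rewrite /qmul.
  by congr (_, _, _, _); ring.
have g1 : generated (1, 1, 0, 1).
  apply: (@generated_mul (-1, 1, -1, 0) (0, -1, 1, 0)); exact: generated_factor.
have g2 : generated (1, -1, 0, 1).
  apply: (@generated_mul (0, 1, -1, 0) (0, -1, 1, -1)); exact: generated_factor.
by case: (intP k) => [|n|n]; [have := nat_case 1 0 g1 | have := nat_case 1 n.+1 g1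
  | have := nat_case (-1) n.+1 g2]; rewrite ?mulr0 ?mul1r ?mulN1r.
Qed.

(* Euclid's algorithm on the first column. *)
Lemma generatedP x : qdet x = 1 -> generated x.
Proof.
case: x => [[[a b] c] d] /=; have [n] := ubnP `|c|%N.
elim: n => // n IH in a b c d *; rewrite ltnS => cn.
have [->|c0] := eqVneq c 0.
  rewrite mulr0 subr0 => ad.
  have ga : (a = 1 /\ d = 1) \/ (a = -1 /\ d = -1).
    have /eqP : (`|a| * `|d| = 1)%N by rewrite -abszM ad.
    rewrite muln_eq1 => /andP[/eqP a1 _].
    have [aE|aE] : a = 1 \/ a = -1 by lia.
      by rewrite aE in ad *; lia.
    by rewrite aE in ad *; lia.
  case: ga => -[-> ->]; first exact: generated_shear.
  rewrite (_ : (_, _, _, _) = qmul (-1, 0, 0, -1) (1, - b, 0, 1)).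
    by apply: generated_mul; [exact: generated_factor | exact: generated_shear].
  by rewrite /qmul; congr (_, _, _, _); ring.
move=> det1; pose q := (a %/ c)%Z.
have aE : a = q * c + (a %% c)%Z := divz_eq a c.
have r_lt : (`|(a %% c)%Z| < `|c|)%N.
  by have := modz_ge0 a c0; have := ltz_mod a c0; lia.
(* One division step: subtracting [q] times the second row and applying a quarter turn takes the
   first column from [(a, c)] to [(- c, a %% c)]. *)
rewrite (_ : (a, b, c, d) =
  qmul (qmul (1, q, 0, 1) (0, 1, -1, 0)) (- c, - d, (a %% c)%Z, b - q * d)).
  apply: generated_mul.
    by apply: generated_mul; [exact: generated_shear | exact: generated_factor].
  apply: IH; first by apply: leq_trans r_lt _.
  rewrite -det1; rewrite [X in _ = X * _ - _]aE; ring.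
by rewrite /qmul; congr (_, _, _, _); rewrite ?[LHS]aE; ring.
Qed.

(** * Computations over SL(2,Z) as parse trees *)

Section Triangulation.
Variable A : GAut (SL2 int) unit.
Local Notation runA := (@run (SL2 int) (@SL2_mul int) (SL2_one int) unit A).

Lemma factorization_ex (M : SL2 int) :
  exists l, all (mem factors) l && (qprod l == quad_of M).
Proof.
by have [l lf lM] := generatedP (qdet_quad_of M); exists l; rewrite lf lM eqxx.
Qed.

Definition factorization M := xchoose (factorization_ex M).

Lemma factorization_factors M : all (mem factors) (factorization M).
Proof. by have /andP[] := xchooseP (factorization_ex M). Qed.

Lemma factorizationK M : qprod (factorization M) = quad_of M.
Proof. by have /andP[_ /eqP] := xchooseP (factorization_ex M). Qed.

(** All suffixes of the chosen factorizations of register updates: a finite set closed under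
    removing the head, which keeps the set of labels finite. *)
Definition pending : seq (seq zquad) :=
  [::] :: [seq drop i l | l <- [seq factorization t.2 | t <- gtrans A],
                          i <- iota 0 (size l).+1].

Lemma pending_factorization q o q' M :
  List.In (q, o, q', M) (gtrans A) -> factorization M \in pending.
Proof.
move=> tr; rewrite inE; apply/orP; right.
apply/allpairsPdep; exists (factorization M), 0%N; split; rewrite ?drop0 //.
elim: (gtrans A) tr => //= t ts IH [->|/IH]; rewrite inE ?eqxx // => ->.
by rewrite orbT.
Qed.

Lemma pending_behead g l : g :: l \in pending -> l \in pending.
Proof.
rewrite inE => /orP[//|/allpairsPdep[m [i [mf + lE]]]].
rewrite mem_iota inE => _; apply/orP; right.
apply/allpairsPdep; exists m, i.+1; split=> //; last first.
  by rewrite -[i.+1]add1n -drop_drop -lE /= drop0.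
have := congr1 size lE; rewrite size_drop mem_iota /=; lia.
Qed.

(* (q, l): state q, with the factors l still to be multiplied into the register. *)
Definition vertex : Type := (gstate A * seq zquad)%type.
Definition label : Type := (vertex * zquad * vertex)%type.

(** A transition counts its letter and only queues its update, hence the factor 1; the queued
    factors are then multiplied in one at a time, at weight 0. *)
Inductive leaf : label -> nat -> Prop :=
| leaf_trans q o q' M : List.In (q, o, q', M) (gtrans A) ->
    leaf ((q, [::]), qone _, (q', factorization M)) (isSome o)
| leaf_pop q g l : g \in factors -> g :: l \in pending ->
    leaf ((q, g :: l), g, (q, l)) 0.

Inductive node : label -> label -> label -> Prop :=
| node_mul u g v h w : qmul g h \in factors ->
    node (u, qmul g h, w) (u, g, v) (v, h, w).

Local Notation tree := (tree leaf node).

Definition vertices : seq vertex := [seq (q, l) | q <- enum (gstate A), l <- pending].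
Definition labels : seq label :=
  [seq (p, v) | p <- [seq (u, g) | u <- vertices, g <- factors], v <- vertices].

Lemma mem_vertices (q : gstate A) l : ((q, l) \in vertices) = (l \in pending).
Proof.
apply/allpairsP/idP => [[[q1 l1] [_ ? [_ ->]]]|lp] //.
by exists (q, l); rewrite mem_enum.
Qed.

Lemma mem_labels u g v :
  ((u, g, v) \in labels) = [&& u \in vertices, g \in factors & v \in vertices].
Proof.
apply/allpairsP/and3P => [[[p v1] [/allpairsP[[u1 g1] /= [u1v g1f ->]] v1v [-> -> ->]]]|].
  by [].
by case=> uv gf vv; exists ((u, g), v); split=> //; apply/allpairsP; exists (u, g).
Qed.

Lemma tree_labels x n : tree x n -> x \in labels.
Proof.
elim=> {x n} [x n []|x y z n m []].
- move=> q o q' M /pending_factorization Mp.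
  by rewrite mem_labels !mem_vertices Mp.
- by move=> q g l gf glp; rewrite mem_labels !mem_vertices gf glp (pending_behead glp).
move=> u g v h w ghf _ + _; rewrite !mem_labels ghf.
by move=> /and3P[-> _ _] /and3P[_ _ ->].
Qed.

Lemma leaf_le1 x n : leaf x n -> (n <= 1)%N.
Proof. by case=> // q o *; apply: leq_b1. Qed.

(** (factor multiplied into the register, number of letters read, target). *)
Definition edge : Type := (zquad * nat * vertex)%type.

Fixpoint chain (u : vertex) (s : seq edge) : Prop :=
  if s is (g, n, v) :: s' then tree (u, g, v) n /\ chain v s' else True.

Definition chain_end u (s : seq edge) := last u [seq e.2 | e <- s].
Definition chain_prod (s : seq edge) := qprod [seq e.1.1 | e <- s].
Definition chain_weight (s : seq edge) := sumn [seq e.1.2 | e <- s].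

Lemma chain_cat u s1 s2 :
  chain u (s1 ++ s2) <-> chain u s1 /\ chain (chain_end u s1) s2.
Proof.
by elim: s1 u => [|[[g n] v] s1 IH] u //=; [tauto | have := IH v; tauto].
Qed.

Lemma chain_factors u s : chain u s -> all (mem factors) [seq e.1.1 | e <- s].
Proof.
elim: s u => [|[[g n] v] s IH] u //= [/tree_labels].
by rewrite mem_labels => /and3P[_ -> _] /IH ->.
Qed.

(** Induction on the length: as long as two edges remain, [qprod1_mergeable] yields adjacent ones
    that a [node] combines into a single edge. *)
Lemma chain_collapse u s : chain u s -> s != [::] -> chain_prod s = qone _ ->
  tree (u, qone _, chain_end u s) (chain_weight s).
Proof.
have [k] := ubnP (size s); elim: k => // k IH in s *; rewrite ltnS => sk us s0 s1.
have [s_gt1|] := ltnP 1 (size s); last first.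
  case: s => [|[[g n] v] [|]] // in us s0 s1 {sk} *.
  by move=> _; move: s1 us; rewrite /chain_prod /chain_weight /= qmul1 addn0 => -> [].
have sf := chain_factors us.
have [|//|r1 [g [h [r2 [rE gh]]]]] := qprod1_mergeable sf; first by rewrite size_map.
have dE : [seq e.1.1 | e <- drop (size r1) s] = g :: h :: r2.
  by rewrite map_drop rE drop_size_cat.
move: us s0 s1 sk; rewrite -[s](cat_take_drop (size r1)).
case: (drop _ _) dE => [|[[g' n] v] [|[[h' m] w] s2]] //= [-> -> _].
move: (take _ _) => s1' /chain_cat[us1 [gn [hm ws2]]] _.
rewrite /chain_prod /chain_weight /chain_end !map_cat /= qprod_cat /= qmulA size_cat /=.
move=> s1 sk; rewrite last_cat /=.
have := IH (s1' ++ (qmul g h, (n + m)%N, w) :: s2).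
rewrite /chain_prod /chain_weight /chain_end !map_cat /= qprod_cat /= size_cat last_cat /=.
rewrite !sumn_cat /= -addnA; apply.
- by rewrite !addnS in sk *.
- by apply/chain_cat; split=> //; split=> //; apply: tree_node gn hm; apply: node_mul.
- by case: (s1').
- by rewrite -s1 !qmulA.
Qed.

Definition acceptable (u : vertex) (g : zquad) (n : nat) := exists s q,
  [/\ q \in gacc A, chain u s, chain_end u s = (q, [::]), chain_prod s = g
    & chain_weight s = n].

Lemma acceptable_cons u g v n h m :
  tree (u, g, v) n -> acceptable v h m -> acceptable u (qmul g h) (n + m).
Proof.
move=> uv [s [q [qacc vs send sprod sw]]]; exists ((g, n, v) :: s), q; split=> //.
- by rewrite -sprod.
- by rewrite -sw.
Qed.

Lemma acceptable_pop q l g n : all (mem factors) l -> l \in pending ->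
  acceptable (q, [::]) g n -> acceptable (q, l) (qmul (qprod l) g) n.
Proof.
move=> + + acc; elim: l => [|h l IH] /=; first by rewrite q1mul.
case/andP=> hf lf hlp; rewrite -qmulA -[n]add0n.
apply: (acceptable_cons (v := (q, l))).
  by apply: tree_leaf; apply: leaf_pop.
exact: IH lf (pending_behead hlp).
Qed.

(** [g] is the product of the updates still to come; each transition becomes one leaf followed by a
    pop for each factor of its update. *)
Lemma run_acceptable q x w : runA q x w ->
  exists2 g, qmul (quad_of x) g = qone _ & acceptable (q, [::]) g (size w).
Proof.
have step q1 o q2 M n y : List.In (q1, o, q2, M) (gtrans A) ->
    (exists2 g, qmul (quad_of (SL2_mul y M)) g = qone _ & acceptable (q2, [::]) g n) ->
    exists2 g, qmul (quad_of y) g = qone _ & acceptable (q1, [::]) g (isSome o + n).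
  move=> tr [g g1 acc]; exists (qmul (quad_of M) g); first by rewrite qmulA -quad_of_mul.
  have := acceptable_pop (factorization_factors M) (pending_factorization tr) acc.
  rewrite factorizationK => accM; rewrite -[qmul _ g]q1mul.
  apply: acceptable_cons accM; apply: tree_leaf; exact: leaf_trans tr.
elim=> {q x w} [q x qacc ->|q x a w q' M tr _ acc|q x w q' M tr _ acc].
- exists (qone _); first by rewrite quad_of_one qmul1.
  by exists [::], q.
- exact: step tr acc.
- exact: step tr acc.
Qed.

(** The automaton applies a whole update at once, so its register [M] already contains the factors
    that are pending at [u]. *)
Definition config_run (u : vertex) (x : zquad) (w : seq unit) :=
  forall M : SL2 int, quad_of M = qmul x (qprod u.2) -> runA u.1 M w.

(** The continuation [w] makes a [node] the composition of its two induction hypotheses. *)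
Lemma tree_sound lbl n : tree lbl n -> forall x w,
  config_run lbl.2 (qmul x lbl.1.2) w -> config_run lbl.1.1 x (nseq n tt ++ w).
Proof.
elim=> {lbl n} [lbl n []|lbl y z n m []] /=.
- move=> q o q' M tr x w acc N /=; rewrite qmul1 => NE.
  have acc' : runA q' (SL2_mul N M) w.
    by apply: acc; rewrite /= quad_of_mul factorizationK qmul1 NE.
  by case: o => [[]|] in tr *; [apply: run_read tr _ | apply: run_eps tr _].
- by move=> q g l _ _ x w acc N /= NE; apply: acc; rewrite /= NE qmulA.
move=> u g v h t _ _ IH1 _ IH2 x w acc.
rewrite nseqD -catA; apply: IH1; apply: IH2 => /=.
by rewrite -qmulA.
Qed.

Lemma accepts_tree w : accepts (@SL2_mul int) (SL2_one int) A w -> (0 < size w)%N ->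
  exists2 q, q \in gacc A & tree ((ginit A, [::]), qone _, (q, [::])) (size w).
Proof.
move=> /run_acceptable[g]; rewrite quad_of_one q1mul => -> [s [q [qacc us send s1 sw]]].
move=> w0; exists q => //; rewrite -send -sw; apply: chain_collapse => //.
by apply: contraTneq w0 => s0; rewrite -sw s0.
Qed.

Lemma tree_accepts q n : q \in gacc A ->
  tree ((ginit A, [::]), qone _, (q, [::])) n ->
  accepts (@SL2_mul int) (SL2_one int) A (nseq n tt).
Proof.
move=> qacc /tree_sound /(_ (qone _) [::]); rewrite cats0; apply=> /=; last first.
  by rewrite quad_of_one q1mul.
move=> M; rewrite !q1mul => /= ME; apply: run_end => //.
by apply: quad_of_inj; rewrite ME quad_of_one.
Qed.

Lemma unary_pump : exists N, forall n, (N <= n)%N ->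
  accepts (@SL2_mul int) (SL2_one int) A (nseq n tt) ->
  exists2 k, (0 < k)%N &
    forall i, accepts (@SL2_mul int) (SL2_one int) A (nseq (n + i * k) tt).
Proof.
exists (2 ^ size labels)%N => n nN acc.
have n0 : (0 < n)%N by apply: leq_trans nN; rewrite expn_gt0.
have [|q qacc] := accepts_tree acc; rewrite size_nseq // => qn.
have [k k0 pump] := tree_pump leaf_le1 tree_labels qn nN.
by exists k => // i; apply: tree_accepts qacc (pump i).
Qed.

End Triangulation.

(** * The powers of four *)

Definition pow4_word (w : seq unit) : Prop := exists n, size w = (4 ^ n)%N.

Lemma pow4_not_int : ~ L_SL2 int pow4_word.
Proof.
case=> A LA; have [N pump] := unary_pump A.
have N_le : (N <= 4 ^ N)%N by apply: ltnW; apply: ltn_expl.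
have /LA acc : pow4_word (nseq (4 ^ N) tt) by exists N; rewrite size_nseq.
have [k k0 accs] := pump _ N_le acc.
apply: (@pow4_pump k k0 N) => i; have /LA[m] := accs i.
by rewrite size_nseq; exists m.
Qed.

(** * An automaton over SL(2,Q) for the powers of four *)

Section Rational.
Local Notation rquad := (rat * rat * rat * rat)%type.

Definition scaleq : rquad := (2, 0, 0, 2^-1).
Definition unscaleq : rquad := (2^-1, 0, 0, 2).
Definition shearq : rquad := (1, 1, 0, 1).
Definition unshearq : rquad := (1, -1, 0, 1).

Lemma scale_det : qdet scaleq = 1. Proof. by []. Qed.
Lemma unscale_det : qdet unscaleq = 1. Proof. by []. Qed.
Lemma shear_det : qdet shearq = 1. Proof. by []. Qed.
Lemma unshear_det : qdet unshearq = 1. Proof. by []. Qed.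

Definition grow : option bool := None.
Definition shrink : option bool := Some false.
Definition count_state : option bool := Some true.

Definition pow4_aut : GAut (SL2 rat) unit := {|
  gstate := option bool;
  ginit := grow;
  gacc := [set count_state];
  gtrans := [:: (grow, None, grow, SL2_of_quad scale_det);
                (grow, None, shrink, SL2_of_quad shear_det);
                (shrink, None, shrink, SL2_of_quad unscale_det);
                (shrink, None, count_state, SL2_one rat);
                (count_state, Some tt, count_state, SL2_of_quad unshear_det)] |}.

Local Notation run4 :=
  (@run (SL2 rat) (@SL2_mul rat) (SL2_one rat) unit pow4_aut).

(* E^n, E^n D^m and D^p E: the registers from which count_state and shrink accept
   a^n, and the effect of p further rounds in grow. *)
Definition count_reg (n : nat) : rquad := (1, n%:R, 0, 1).
Definition shrink_reg (n m : nat) : rquad := (2 ^+ m, n%:R / 2 ^+ m, 0, 2 ^- m).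
Definition grow_reg (p : nat) : rquad := (2 ^+ p, 2 ^+ p, 0, 2 ^- p).

Definition accepting (q : option bool) (x : rquad) (n : nat) : Prop :=
  match q with
  | None => exists p m, qmul x (grow_reg p) = shrink_reg n m
  | Some false => exists m, x = shrink_reg n m
  | Some true => x = count_reg n
  end.

Lemma mul_unshear x n : qmul x unshearq = count_reg n -> x = count_reg n.+1.
Proof.
move=> E; have := congr1 (fun y => qmul y shearq) E.
rewrite -qmulA (_ : qmul unshearq _ = qone _) ?qmul1 // => ->.
by rewrite /qmul /count_reg /= -[n.+1]addn1 natrD; congr (_, _, _, _); ring.
Qed.

Lemma mul_unscale x n m : qmul x unscaleq = shrink_reg n m -> x = shrink_reg n m.+1.
Proof.
move=> E; have := congr1 (fun y => qmul y scaleq) E.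
rewrite -qmulA (_ : qmul unscaleq _ = qone _) ?qmul1 // => ->.
have p0 : (2 : rat) ^+ m != 0 by rewrite expf_neq0.
by rewrite /qmul /shrink_reg /= exprS; congr (_, _, _, _); field.
Qed.

Lemma scale_grow p : qmul scaleq (grow_reg p) = grow_reg p.+1.
Proof.
have p0 : (2 : rat) ^+ p != 0 by rewrite expf_neq0.
by rewrite /qmul /grow_reg /= exprS; congr (_, _, _, _); field.
Qed.

(** Induction from the end of the run: each transition is undone by the inverse of its update. *)
Lemma run_accepting q x w : run4 q x w -> accepting q (quad_of x) (size w).
Proof.
elim=> {q x w} [q x|q x a w q' M tr _|q x w q' M tr _].
- by rewrite inE => /eqP-> ->; rewrite quad_of_one.
- rewrite quad_of_mul; move: tr; do 5 case=> [[<- // _ <- <-]|]; rewrite ?SL2_of_quadK //=.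
  by move/mul_unshear.
rewrite quad_of_mul; move: tr.
case=> [[<- <- <-]|]; rewrite ?SL2_of_quadK /=.
  by case=> p [m]; rewrite -qmulA scale_grow; exists p.+1, m.
case=> [[<- <- <-]|]; rewrite ?SL2_of_quadK /=.
  by case=> m E; exists 0%N, m; rewrite -E.
case=> [[<- <- <-]|]; rewrite ?SL2_of_quadK /=.
  by case=> m /mul_unscale; exists m.+1.
case=> [[<- <- <-]|]; rewrite ?quad_of_one /=.
  by rewrite qmul1 => ->; exists 0%N; rewrite /shrink_reg !expr0 invr1 divr1.
by case.
Qed.

Lemma run_count x w : quad_of x = count_reg (size w) -> run4 count_state x w.
Proof.
elim: w x => [|[] w IH] x xE.
  by apply: run_end; [rewrite inE | apply: quad_of_inj; rewrite xE quad_of_one].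
apply: (@run_read _ _ _ _ pow4_aut _ _ _ _ count_state (SL2_of_quad unshear_det)).
  by do 4 right; left.
apply: IH; rewrite quad_of_mul SL2_of_quadK xE /qmul /count_reg /= -[(size w).+1]addn1 natrD.
by congr (_, _, _, _); ring.
Qed.

Lemma run_shrink x w m : quad_of x = shrink_reg (size w) m -> run4 shrink x w.
Proof.
elim: m x => [|m IH] x xE.
  apply: (@run_eps _ _ _ _ pow4_aut _ _ _ count_state (SL2_one rat)).
    by do 3 right; left.
  by apply: run_count; rewrite quad_of_mul quad_of_one qmul1 xE /shrink_reg !expr0 invr1 divr1.
apply: (@run_eps _ _ _ _ pow4_aut _ _ _ shrink (SL2_of_quad unscale_det)).
  by do 2 right; left.
apply: IH; rewrite quad_of_mul SL2_of_quadK xE.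
have p0 : (2 : rat) ^+ m != 0 by rewrite expf_neq0.
by rewrite /qmul /shrink_reg /= exprS; congr (_, _, _, _); field.
Qed.

Lemma run_grow x w p m :
  qmul (quad_of x) (grow_reg p) = shrink_reg (size w) m -> run4 grow x w.
Proof.
elim: p x => [|p IH] x xE.
  apply: (@run_eps _ _ _ _ pow4_aut _ _ _ shrink (SL2_of_quad shear_det)).
    by right; left.
  by apply: (@run_shrink _ _ m); rewrite quad_of_mul SL2_of_quadK -xE.
apply: (@run_eps _ _ _ _ pow4_aut _ _ _ grow (SL2_of_quad scale_det)).
  by left.
by apply: IH; rewrite quad_of_mul SL2_of_quadK -qmulA scale_grow.
Qed.

Lemma pow4_rat : L_SL2 rat pow4_word.
Proof.
exists pow4_aut => w; split=> [[p wE]|/run_accepting].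
  apply: (@run_grow _ _ p p); rewrite quad_of_one q1mul wE.
  have p0 : (2 : rat) ^+ p != 0 by rewrite expf_neq0.
  by rewrite /shrink_reg natrX (_ : 4%:R = 2 * 2 :> rat) // exprMn mulfK.
rewrite /= quad_of_one => -[p [m]]; rewrite q1mul => -[pm E _]; exists p.
have p0 : (2 : rat) ^+ p != 0 by rewrite expf_neq0.
(* The upper left entries give [2 ^+ p = 2 ^+ m], so the upper right ones say that the length is
   [2 ^+ p * 2 ^+ p]. *)
move: E; rewrite -pm => /(congr1 ( *%R^~ (2 ^+ p))) /=; rewrite mulfVK // -exprMn => E.
by apply/eqP; rewrite -(eqr_nat rat) natrX -E; apply/eqP; congr (_ ^+ _).
Qed.

End Rational.

Theorem theorem3p11 :
  (forall (Sigma : finType) (L : seq Sigma -> Prop),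
      L_SL2 int L -> L_SL2 rat L) /\
  (exists (Sigma : finType) (L : seq Sigma -> Prop),
      L_SL2 rat L /\ ~ L_SL2 int L).
Proof.
split; first exact: L_SL2_int_rat.
by exists unit, pow4_word; split; [exact: pow4_rat | exact: pow4_not_int].
Qed.
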